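(* For every integer $k\geq 3$, \[ \sum_{\substack{\lambda\vdash k\\ l(\lambda)=5,\ \lambda_5=1}} f_\lambda=\frac{\lfloor\frac{k+1}{2}\rfloor\left(\lceil\frac{k+1}{2}\rceil+1\right)}{k+1}\,C_{\lfloor\frac{k+1}{2}\rfloor}C_{\lceil\frac{k+1}{2}\rceil}-C_{\lfloor\frac{k}{2}\rfloor+1}C_{\lceil\frac{k}{2}\rceil+1}+M_k . \]
   Context: $f_\lambda$ is the number of standard Young tableaux of shape $\lambda$ and $l(\lambda)$ is the number of parts of $\lambda$; so the left side counts standard Young tableaux with exactly $5$ rows whose fifth row has length $1$. $C_i=\frac{1}{i+1}\binom{2i}{i}$ is the $i$-th Catalan number and $M_k=\sum_{i\ge 0}\frac{1}{i+1}\binom{k}{2i}\binom{2i}{i}$ is the $k$-th Motzkin number. *)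

(* Defs.v *)
From HB Require Import structures.
From mathcomp Require Import all_boot all_order all_algebra.
Unset Strict Implicit. Unset Printing Implicit Defensive.
Import Order.TTheory GRing.Theory Num.Theory.

Definition is_partition (n : nat) (la : seq nat) : bool :=
  [&& sorted geq la, all (fun x => 0 < x) la & sumn la == n].

Definition in_shape (la : seq nat) (c : nat * nat) : bool :=
  (c.1 < size la) && (c.2 < nth 0 la c.1).

(* A standard Young tableau of shape la (with n = sumn la cells), encoded by
   f : entry a (in 0..n-1, i.e. the label a+1) |-> its cell.  f is a bijection
   from the labels onto the cells of la (injective with image inside the shape,
   and there are exactly n cells), and entries increase along rows and columns:
   if cell(a) is weakly north-west of cell(b) then a <= b. *)
Definition is_SYT (la : seq nat) (f : {ffun 'I_(sumn la) -> 'I_(sumn la) * 'I_(sumn la)}) : bool :=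
  [&& injectiveb f,
      [forall a, in_shape la (nat_of_ord (f a).1, nat_of_ord (f a).2)] &
      [forall a, forall b,
         (((f a).1 <= (f b).1)%N && ((f a).2 <= (f b).2)%N) ==> (a <= b)%N]].

Definition num_SYT (la : seq nat) : nat := #|[pred f | is_SYT la f]|.

Local Open Scope ring_scope.

Definition catalan (i : nat) : rat := (i.+1)%:R^-1 * ('C(i.*2, i))%:R.

(* Motzkin number M_k = sum_{i>=0} 1/(i+1) binom(k,2i) binom(2i,i)
   (terms with 2i > k vanish, so the sum over i <= k is the full sum). *)
Definition motzkin (k : nat) : rat :=
  \sum_(i < k.+1) (i.+1)%:R^-1 * ('C(k, i.*2))%:R * ('C(i.*2, i))%:R.

(* Main.v *)
Require Import Defs.
From HB Require Import structures.
From mathcomp Require Import all_boot all_order all_algebra.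
From mathcomp Require Import zify ring lra.
Import Order.TTheory GRing.Theory Num.Theory.

(** Reading off the row of each entry turns a standard tableau into a lattice
    word, i.e. a growth of shapes from the empty one. A shape with at most four
    rows is a configuration of four non-colliding particles, and the number
    [W n] of growths of length [n] from it is a Pfaffian in walks of the
    quarter plane; from the empty shape it is a product of two Catalan numbers,
    because a planar walk splits into two independent walks on the line. With
    three rows the same Pfaffian gives lazy walks, hence Motzkin numbers.

    Let [b n] count the tableaux of size [n] in the theorem. Since [D U - U D = 1]
    in Young's lattice, the pairs (growth of length [n], removal of a cell leaving
    at most four rows) number [n * W (n - 1)]. A tableau counted by [b n] allows
    one such removal; a shape with at most four rows has one addable cell more
    than removable ones, counting rows one to four, and equally many if its
    fourth row is nonempty. Hence [n * W (n - 1) = b n + W (n + 1) - M n].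
    The same identity from an arbitrary initial shape is proved by induction
    on [n]. *)


(** * Standard tableaux and lattice words *)

Definition incr (i : nat) (mu : nat -> nat) : nat -> nat := fun j => (mu j + (j == i)).

Definition addable (i : nat) (mu : nat -> nat) : bool := (i == 0) || (mu i < mu i.-1).

Fixpoint growths (n : nat) (mu : nat -> nat) : nat :=
  if n is m.+1 then (\sum_(i < 5) (if addable i mu then growths m (incr i mu) else 0))
  else (mu 4 == 1).

Lemma card_bij_initial (T : finType) (S : {set T}) (g : T -> nat) (c : nat) :
  {in S &, injective g} -> (forall b, b \in S -> g b < c) ->
  (forall j, j < c -> exists2 b, b \in S & g b = j) -> #|S| = c.
Proof.
move=> ginj gle gsurj; rewrite cardE -(size_map g) -(size_iota 0 c).
apply/perm_size/uniq_perm; rewrite ?iota_uniq //.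
  by rewrite map_inj_in_uniq ?enum_uniq // => x y; rewrite !mem_enum; exact: ginj.
move=> j; rewrite mem_iota /= add0n; apply/mapP/idP => [[b]|/gsurj[b bS <-]].
  by rewrite mem_enum => bS ->; exact: gle.
by exists b; rewrite ?mem_enum.
Qed.

Lemma leq_card_surj (T : finType) (S : {set T}) (g : T -> nat) (c : nat) :
  (forall j, j < c -> exists2 b, b \in S & g b = j) -> c <= #|S|.
Proof.
move=> gsurj; rewrite cardE -(size_map g) -(size_iota 0 c).
apply: uniq_leq_size (iota_uniq _ _) _ => j; rewrite mem_iota /= add0n => /gsurj[b bS <-].
by rewrite map_f // mem_enum.
Qed.

(** When [x] gives the rows of the entries, this is the length of row [r] once the first [m] entries
    are placed. *)
Definition before n (x : 'I_n -> nat) (r m : nat) : nat :=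
  #|[set b : 'I_n | (b < m) && (x b == r)]|.

Lemma eq_before n (x y : 'I_n -> nat) r m : x =1 y -> before n x r m = before n y r m.
Proof. by move=> xy; congr #|pred_of_set _|; apply/setP => b; rewrite !inE xy. Qed.

Lemma leq_before n (x : 'I_n -> nat) r m m' : m <= m' -> before n x r m <= before n x r m'.
Proof.
move=> mm; apply/subset_leq_card/subsetP => b; rewrite !inE => /andP[bm ->].
by rewrite (leq_trans bm).
Qed.

Lemma ltn_before n (x : 'I_n -> nat) (b : 'I_n) m : b < m -> before n x (x b) b < before n x (x b) m.
Proof.
move=> bm; apply/proper_card/properP; split; last by exists b; rewrite !inE ?eqxx ?bm ?ltnn.
by apply/subsetP => c; rewrite !inE => /andP[cb ->]; rewrite (ltn_trans cb).
Qed.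

Lemma before0 n (x : 'I_n -> nat) r : before n x r 0 = 0.
Proof. by apply/eqP; rewrite cards_eq0; apply/eqP/setP => b; rewrite !inE. Qed.

Lemma beforeS n (x : 'I_n -> nat) r m (hm : m < n) :
  before n x r m.+1 = before n x r m + (x (Ordinal hm) == r).
Proof.
pose a := Ordinal hm; rewrite /before.
rewrite (cardsD1 a) inE ltnSn /= addnC; congr (_ + _).
apply: eq_card => b; rewrite !inE ltnS [b <= m]leq_eqVlt -(inj_eq val_inj) /=.
by case: eqVneq => [->|] //=; rewrite ltnn.
Qed.

Definition cells (la : seq nat) : seq (nat * nat) :=
  [seq (i, j) | i <- iota 0 (size la), j <- iota 0 (nth 0 la i)].

Lemma size_cells la : size (cells la) = sumn la.
Proof.
rewrite /cells size_allpairs_dep; congr sumn.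
by under eq_map => i do rewrite size_iota; rewrite map_nth_iota0 ?take_size.
Qed.

Lemma mem_cells la c : (c \in cells la) = in_shape la c.
Proof.
apply/allpairsPdep/idP => [[i [j [+ + ->]]]|/andP[h1 h2]].
  by rewrite !mem_iota /in_shape /= !add0n => -> ->.
by exists c.1, c.2; rewrite !mem_iota -surjective_pairing.
Qed.

(** * The row word of a standard tableau *)

Section RowWord.

Variables (la : seq nat) (f : {ffun 'I_(sumn la) -> 'I_(sumn la) * 'I_(sumn la)}).
Hypothesis fSYT : is_SYT la f.
Hypothesis la_sorted : sorted geq la.

Let n := sumn la.
Let row (a : 'I_n) : nat := (f a).1.
Let col (a : 'I_n) : nat := (f a).2.

Lemma SYT_inj a b : row a = row b -> col a = col b -> a = b.
Proof.
case/and3P: fSYT => /injectiveP finj _ _ rab cab.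
by apply: finj; rewrite [f a]surjective_pairing [f b]surjective_pairing; congr pair; exact: val_inj.
Qed.

Lemma SYT_shape a : row a < size la /\ col a < nth 0 la (row a).
Proof. by case/and3P: fSYT => _ /forallP/(_ a)/andP. Qed.

Lemma SYT_mono a b : row a <= row b -> col a <= col b -> a <= b.
Proof.
case/and3P: fSYT => _ _ /forallP/(_ a)/forallP/(_ b)/implyP mono r c.
by apply: mono; rewrite r c.
Qed.

(** Pigeonhole: the entries occupy distinct cells of the shape, and there are as many entries as
    cells. *)
Lemma SYT_surj i j : i < size la -> j < nth 0 la i -> exists2 a, row a = i & col a = j.
Proof.
move=> hi hj; pose s := [seq (row a, col a) | a <- enum 'I_n].
have us : uniq s.
  by rewrite map_inj_uniq ?enum_uniq // => a b [] /SYT_inj; exact.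
have sub : {subset s <= cells la}.
  move=> c /mapP[a _ ->]; rewrite mem_cells /in_shape /=.
  by case: (SYT_shape a) => -> ->.
have [|_ E] := uniq_min_size us sub; first by rewrite size_cells size_map size_enum_ord.
have : (i, j) \in s by rewrite E mem_cells /in_shape hi hj.
by case/mapP => a _ [-> ->]; exists a.
Qed.

(** Entries increase along the row, so those preceding [a] in it are the ones to its left, and no
    column there is left empty. *)
Lemma SYT_before a : before n row (row a) a = col a.
Proof.
apply: (@card_bij_initial _ _ col) => [b c|b|j hj].
- by rewrite !inE => /andP[_ /eqP rb] /andP[_ /eqP rc] /SYT_inj; apply; rewrite rb.
- rewrite inE => /andP[ba /eqP rb]; rewrite ltnNge; apply/negP => cab.
  by have := SYT_mono a b; rewrite rb leqnn => /(_ isT cab); rewrite leqNgt ba.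
- have [ra ca] := SYT_shape a.
  have [b rb cb] := SYT_surj _ _ ra (ltn_trans hj ca).
  exists b => //; rewrite inE rb eqxx andbT ltn_neqAle SYT_mono ?rb ?cb //; last exact: ltnW.
  rewrite andbT; apply/eqP => ba.
  by move: hj; rewrite -cb -(_ : b = a) ?ltnn //; exact: val_inj.
Qed.

Lemma SYT_content i : i < size la -> before n row i n = nth 0 la i.
Proof.
move=> hi; apply: (@card_bij_initial _ _ col) => [b c|b|j hj].
- by rewrite !inE => /andP[_ /eqP rb] /andP[_ /eqP rc] /SYT_inj; apply; rewrite rb.
- by rewrite inE => /andP[_ /eqP <-]; case: (SYT_shape b).
- by have [b rb cb] := SYT_surj _ _ hi hj; exists b; rewrite ?inE ?ltn_ord ?rb /=.
Qed.

(** In the row above, every cell up to the column of [a] holds an earlier entry, so that row is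
    strictly longer when [a] arrives. *)
Lemma SYT_lattice a : addable (row a) (before n row ^~ a).
Proof.
rewrite /addable; case E: (row a) => [|r] //=.
rewrite -E SYT_before; apply: (@leq_card_surj _ _ col) => j hj.
have [ra ca] := SYT_shape a; rewrite E in ra ca.
have le : nth 0 la r.+1 <= nth 0 la r by apply: (sorted_leq_nth (rev_trans leq_trans)) => //; rewrite ?inE //; exact: ltnW.
have [|b rb cb] := SYT_surj r j (ltnW ra); first exact: leq_trans (leq_trans hj ca) le.
exists b => //; rewrite inE rb eqxx andbT ltn_neqAle SYT_mono ?rb ?cb ?E ?andbT //.
by apply/eqP => /val_inj ba; move: rb; rewrite ba E => /eqP; rewrite eqn_leq ltnn.
Qed.

End RowWord.

(** * Lattice words as a condition on prefixes *)

Fixpoint yamanouchi (mu : nat -> nat) (w : seq nat) : bool :=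
  if w is i :: w' then addable i mu && yamanouchi (incr i mu) w' else true.

Lemma eq_addable i mu nu : mu =1 nu -> addable i mu = addable i nu.
Proof. by move=> e; rewrite /addable !e. Qed.

Lemma yamanouchiP mu w :
  reflect (forall m, m < size w ->
             addable (nth 0 w m) (fun j => mu j + count_mem j (take m w)))
          (yamanouchi mu w).
Proof.
elim: w mu => [|i w IH] mu /=; first by left.
apply: (iffP andP) => [[ai /IH H] [|m] /= hm|H].
- by rewrite (eq_addable _ _ mu) // => j; rewrite addn0.
- rewrite (eq_addable _ _ (fun j => incr i mu j + count_mem j (take m w))); first exact: H.
  by move=> j; rewrite /incr (eq_sym j) addnA.
- split; first by have := H 0 isT; rewrite /= (eq_addable _ _ mu) // => j; rewrite addn0.
  apply/IH => m hm; rewrite (eq_addable _ _ (fun j => mu j + count_mem j (take m.+1 (i :: w)))).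
    exact: (H m.+1).
  by move=> j; rewrite /incr (eq_sym j) /= addnA.
Qed.

Definition letters r n (w : n.-tuple 'I_r) : seq nat := map val w.

Lemma nth_letters r n (w : n.-tuple 'I_r) (a : 'I_n) : nth 0 (letters _ _ w) a = tnth w a.
Proof.
by rewrite /letters (nth_map (tnth w a)) ?size_tuple // -tnth_nth.
Qed.

Lemma count_take_letters r n (w : n.-tuple 'I_r) j m : m <= n ->
  count_mem j (take m (letters _ _ w)) = before n (tnth w) j m.
Proof.
have sz : size (letters _ _ w) = n by rewrite size_map size_tuple.
elim: m => [_|m IH hm].
  by rewrite take0 before0.
rewrite (take_nth 0) ?sz // -cats1 count_cat /= addn0 IH ?(ltnW hm) //.
by rewrite beforeS (nth_letters _ _ w (Ordinal hm)).
Qed.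

Lemma yamanouchi_before r n (w : n.-tuple 'I_r) :
  reflect (forall a : 'I_n, addable (tnth w a) (before n (tnth w) ^~ a))
          (yamanouchi (fun=> 0) (letters _ _ w)).
Proof.
have sz : size (letters _ _ w) = n by rewrite size_map size_tuple.
apply: (iffP (yamanouchiP _ _)) => H a.
  have := H a; rewrite sz nth_letters => /(_ (ltn_ord a)).
  by rewrite (eq_addable _ _ (before n (tnth w) ^~ a)) // => j; rewrite count_take_letters // ltnW.
rewrite sz => ha; rewrite (nth_letters _ _ w (Ordinal ha)).
rewrite (eq_addable _ _ (before n (tnth w) ^~ a)); first exact: (H (Ordinal ha)).
by move=> j; rewrite count_take_letters // ltnW.
Qed.

Definition row_word la r (f : {ffun 'I_(sumn la) -> 'I_(sumn la) * 'I_(sumn la)}) :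
  (sumn la).-tuple 'I_r.+1 := [tuple inord (f a).1 | a < sumn la].

(** Inverse of [row_word]: the column of an entry is the number of earlier equal letters. Under the
    hypotheses of [word_tableauE] the default [a] of [insubd] is never taken. *)
Definition word_tableau r la (w : (sumn la).-tuple 'I_r) :
  {ffun 'I_(sumn la) -> 'I_(sumn la) * 'I_(sumn la)} :=
  [ffun a => (insubd a (tnth w a : nat), insubd a (before _ (tnth w) (tnth w a) a))].

Lemma size_le_sumn la : all (fun x => 0 < x) la -> size la <= sumn la.
Proof. by elim: la => //= x la IH /andP[x0 /IH]; lia. Qed.

(** A letter [k.+1] is read only while the counts of [k] and [k.+1] differ strictly, so reading it
    preserves the weak inequality. *)
Lemma before_antitone n (x : 'I_n -> nat) m i j :
  (forall b : 'I_n, addable (x b) (before n x ^~ b)) ->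
  m <= n -> i <= j -> before n x j m <= before n x i m.
Proof.
move=> lat hm /subnKC <-; elim: (j - i) => [|d IH]; first by rewrite addn0.
apply: leq_trans IH; rewrite addnS; move: (i + d) => k.
elim: m hm => [|m IH] hm; first by rewrite !before0.
rewrite !beforeS; have := lat (Ordinal hm); rewrite /addable /=.
have := IH (ltnW hm); case: (eqVneq (x (Ordinal hm)) k.+1) => [->|_] /=; lia.
Qed.

Section WordTableau.

Variables (r : nat) (la : seq nat) (w : (sumn la).-tuple 'I_r).
Hypothesis la_pos : all (fun x => 0 < x) la.
Hypothesis size_la : size la = r.
Hypothesis content : forall i, i < r -> before _ (tnth w) i (sumn la) = nth 0 la i.
Hypothesis lattice : forall a, addable (tnth w a) (before _ (tnth w) ^~ a).

Lemma word_tableau_shape (a : 'I_(sumn la)) :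
  before _ (tnth w) (tnth w a) a < nth 0 la (tnth w a).
Proof. by rewrite -content // (ltn_before _ (tnth w)). Qed.

Lemma word_tableauE (a : 'I_(sumn la)) :
  (((word_tableau r la w a).1 : nat) = tnth w a)
  * (((word_tableau r la w a).2 : nat) = before _ (tnth w) (tnth w a) a).
Proof.
have rn : (tnth w a : nat) < sumn la.
  by apply: leq_trans (size_le_sumn _ la_pos); rewrite size_la.
have cn : before _ (tnth w) (tnth w a) a < sumn la.
  apply: leq_trans (word_tableau_shape a) _; rewrite -content //.
  by rewrite /before (leq_trans (max_card _)) ?card_ord.
by rewrite ffunE /=; split; rewrite val_insubd ?rn ?cn.
Qed.

Lemma word_tableau_SYT : is_SYT la (word_tableau r la w).
Proof.
have mono a b : tnth w a <= tnth w b ->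
    before _ (tnth w) (tnth w a) a <= before _ (tnth w) (tnth w b) b -> a <= b.
  move=> rab; apply: contraTT; rewrite -!ltnNge => ba.
  have [rE|rlt] := eqVneq (tnth w a : nat) (tnth w b).
    by rewrite -rE; rewrite rE; exact: ltn_before.
  (* With [b] in a strictly lower row, the lattice condition puts its column below the current
     length of row [k], hence below that of the row of [a], which is at most the column of [a]. *)
  have := lattice b; rewrite /addable.
  case E: (tnth w b : nat) => [|k] /=; first by lia.
  move=> /leq_trans; apply.
  apply: leq_trans (leq_before _ (tnth w) _ _ _ (ltnW ba)).
  by apply: before_antitone => //; [exact: ltnW | lia].
apply/and3P; split.
- apply/injectiveP => a b ab.
  have rE : tnth w a = tnth w b
    by apply: val_inj; rewrite /= -(word_tableauE a).1 ab word_tableauE.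
  have cE : before _ (tnth w) (tnth w a) a = before _ (tnth w) (tnth w b) b.
    by rewrite -(word_tableauE a).2 ab word_tableauE.
  by apply/val_inj/eqP; rewrite eqn_leq !mono ?cE ?rE.
- apply/forallP => a; rewrite /in_shape /= !word_tableauE word_tableau_shape andbT.
  by rewrite size_la.
- apply/forallP => a; apply/forallP => b; rewrite !word_tableauE.
  by apply/implyP => /andP[]; exact: mono.
Qed.

End WordTableau.

(** [word_tableau] and [row_word] are mutually inverse: the word fixes the rows, and [SYT_before]
    recovers the columns. *)
Lemma num_SYT_yamanouchi r la :
  size la = r.+1 -> all (fun x => 0 < x) la -> sorted geq la ->
  num_SYT la = #|[pred w : (sumn la).-tuple 'I_r.+1 |
     yamanouchi (fun=> 0) (letters _ _ w)
     && [forall i : 'I_r.+1, count_mem (i : nat) (letters _ _ w) == nth 0 la i]]|.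
Proof.
move=> size_la la_pos la_sorted.
have contentE (w : (sumn la).-tuple 'I_r.+1) j :
    count_mem j (letters _ _ w) = before _ (tnth w) j (sumn la).
  by rewrite -count_take_letters // take_oversize // size_map size_tuple.
have row_wordE f a : is_SYT la f -> (tnth (row_word la r f) a : nat) = (f a).1.
  move=> /SYT_shape/(_ a)[ra _]; rewrite tnth_mktuple inordK //.
  by rewrite -size_la.
rewrite /num_SYT -!sum1_card.
rewrite (reindex_onto (word_tableau r.+1 la) (row_word la r)) => [|f fS].
  apply: eq_bigl => w; rewrite !inE; apply/andP/andP => [[fS /eqP wE]|[yw /forallP cw]].
    have eqx : (fun a => (word_tableau r.+1 la w a).1 : nat) =1 tnth w.
      by move=> a; rewrite -[in RHS]wE row_wordE.
    split.
      apply/yamanouchi_before => a; rewrite -eqx.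
      have := SYT_lattice la _ fS la_sorted a.
      rewrite (eq_addable _ _ (before _ (tnth w) ^~ a)) // => j.
      exact: eq_before.
    apply/forallP => i; rewrite contentE -(eq_before _ _ _ _ _ eqx).
    by apply/eqP/SYT_content => //; rewrite size_la.
  have lat := elimT (yamanouchi_before _ _ w) yw.
  have cont i : i < r.+1 -> before _ (tnth w) i (sumn la) = nth 0 la i.
    by move=> hi; rewrite -contentE; have /eqP := cw (Ordinal hi).
  have fS : is_SYT la (word_tableau r.+1 la w) by exact: word_tableau_SYT.
  split=> //; apply/eqP/eq_from_tnth => a; apply/val_inj.
  by rewrite /= row_wordE // word_tableauE.
rewrite inE in fS; apply/ffunP => a; rewrite ffunE.
have bE : before _ (tnth (row_word la r f)) (f a).1 a = (f a).2.
  rewrite -(SYT_before la f fS a); apply: eq_before => b; exact: row_wordE.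
rewrite row_wordE // bE [RHS]surjective_pairing; congr pair; apply: val_inj;
  by rewrite val_insubd ltn_ord.
Qed.

Lemma sum_tuple_cons (T : finType) n (F : n.+1.-tuple T -> nat) :
  \sum_w F w = \sum_(i : T) \sum_(v : n.-tuple T) F [tuple of i :: v].
Proof.
rewrite pair_bigA (reindex (fun p : T * n.-tuple T => [tuple of p.1 :: p.2])) //=.
exists (fun w => (thead w, [tuple of behead w])) => [[i v] _|w _].
  by rewrite theadE; congr pair; apply: val_inj.
by rewrite [RHS]tuple_eta.
Qed.

Lemma growths_words n mu :
  growths n mu = #|[pred w : n.-tuple 'I_5 | yamanouchi mu (letters _ _ w)
                     && (mu 4 + count_mem 4 (letters _ _ w) == 1)]|.
Proof.
rewrite -sum1_card big_mkcond; elim: n mu => [|n IH] mu.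
  rewrite (big_pred1 [tuple]) => [|w]; last by rewrite (tuple0 w) /= eqxx.
  by rewrite inE /= addn0; case: eqP.
rewrite sum_tuple_cons /=; apply: eq_bigr => i _.
case: ifP => ai; last by rewrite big1 // => v _; rewrite inE /= ai.
rewrite IH; apply: eq_bigr => v _; rewrite !inE /= ai /=.
by rewrite /incr addnA (eq_sym 4).
Qed.

Lemma seq5E (s : seq nat) : size s = 5 ->
  s = [:: nth 0 s 0; nth 0 s 1; nth 0 s 2; nth 0 s 3; nth 0 s 4].
Proof. by case: s => [|? [|? [|? [|? [|? []]]]]]. Qed.

Lemma count_letters5 (s : seq nat) : all (fun x => x < 5) s ->
  count_mem 0 s + (count_mem 1 s + (count_mem 2 s + (count_mem 3 s + count_mem 4 s))) = size s.
Proof.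
elim: s => [|x s IH] //= /andP[x5 /IH <-].
by case: x x5 => [|[|[|[|[|x]]]]] //= _; lia.
Qed.

(** Words are grouped by content. A content is a partition into five positive parts because letter
    counts decrease weakly and the letter 4 occurs once. *)
Lemma sum_num_SYT_growths k :
  \sum_(t : 5.-tuple 'I_k.+1 |
     is_partition k (map (@nat_of_ord _) t) && (nat_of_ord (tnth t (inord 4)) == 1))
    num_SYT (map (@nat_of_ord _) t) = growths k (fun=> 0).
Proof.
pose content (w : k.-tuple 'I_5) : 5.-tuple 'I_k.+1 :=
  [tuple inord (count_mem (i : nat) (letters _ _ w)) | i < 5].
have contentE w i : i < 5 -> nth 0 (letters _ _ (content w)) i = count_mem i (letters _ _ w).
  move=> hi; rewrite (nth_letters _ _ _ (Ordinal hi)) tnth_mktuple inordK //.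
  by rewrite ltnS (leq_trans (count_size _ _)) ?size_map ?size_tuple.
have tnth4 (t : 5.-tuple 'I_k.+1) : nat_of_ord (tnth t (inord 4)) = nth 0 (letters _ _ t) 4.
  by rewrite -nth_letters inordK.
rewrite growths_words -sum1_card; symmetry.
rewrite (partition_big content (fun t : 5.-tuple 'I_k.+1 =>
  is_partition k (map (@nat_of_ord _) t) && (nat_of_ord (tnth t (inord 4)) == 1))); last first.
  move=> w; rewrite inE /= add0n => /andP[/yamanouchi_before yw w4].
  have anti i : count_mem i.+1 (letters _ _ w) <= count_mem i (letters _ _ w).
    rewrite -(take_oversize (n := k) (s := letters _ _ w)) ?size_map ?size_tuple //.
    by rewrite !count_take_letters //; exact: before_antitone.
  rewrite tnth4 contentE // w4 andbT.
  have -> : map (@nat_of_ord _) (content w) = letters _ _ (content w) by [].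
  have /seq5E -> : size (letters _ _ (content w)) = 5 by rewrite size_map size_tuple.
  have pos4 : 0 < count_mem 4 (letters _ _ w) by rewrite (eqP w4).
  rewrite !contentE // /is_partition /= !anti pos4 /= addn0.
  rewrite count_letters5 ?size_map ?size_tuple ?eqxx ?andbT; last first.
    by apply/allP => x /mapP[i _ ->]; exact: ltn_ord.
  have pos3 := leq_trans pos4 (anti 3); have pos2 := leq_trans pos3 (anti 2).
  have pos1 := leq_trans pos2 (anti 1); have pos0 := leq_trans pos1 (anti 0).
  by rewrite pos3 pos2 pos1 pos0.
apply: eq_bigr => t /andP[/and3P[t_sorted t_pos /eqP t_sum] t4].
have sz : size (letters _ _ t) = 5 by rewrite size_map size_tuple.
have -> : map (@nat_of_ord _) t = letters _ _ t by [].
rewrite (num_SYT_yamanouchi 4) // t_sum -sum1_card.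
apply: eq_bigl => w; rewrite !inE /= add0n -andbA; congr (_ && _).
rewrite tnth4 in t4.
apply/andP/forallP => [[_ /eqP <-] i|H]; first by rewrite contentE.
split; first by have := H (inord 4); rewrite inordK // (eqP t4).
apply/eqP/eq_from_tnth => i; apply/val_inj; rewrite /= -!nth_letters contentE //.
by rewrite (eqP (H i)).
Qed.
Local Open Scope ring_scope.

(** * Ballot walks *)

(* For [x, y > 0] the number of [n]-step walks from [(x, y)] staying in the open
   quadrant; extended oddly in [x] and in [y] so that no boundary case occurs. *)
Fixpoint quadrant_walks (n : nat) (x y : int) : rat :=
  if n is m.+1 then
    quadrant_walks m (x + 1) y + quadrant_walks m (x - 1) y
    + quadrant_walks m x (y + 1) + quadrant_walks m x (y - 1)
  else (Num.sg x * Num.sg y)%:~R.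

Lemma quadrant_walksC n x y : quadrant_walks n x y = quadrant_walks n y x.
Proof.
elim: n x y => [|n IH] x y /=; first by rewrite mulrC.
by rewrite !(IH x) !(IH _ y); ring.
Qed.

Lemma quadrant_walksN n x y : quadrant_walks n (- x) y = - quadrant_walks n x y.
Proof.
elim: n x y => [|n IH] x y /=; first by rewrite sgrN mulNr rmorphN.
rewrite (_ : - x + 1 = - (x - 1)); last by ring.
rewrite (_ : - x - 1 = - (x + 1)); last by ring.
by rewrite !IH; ring.
Qed.

Lemma quadrant_walks0 n y : quadrant_walks n 0 y = 0.
Proof. by have := quadrant_walksN n 0 y; rewrite oppr0; lra. Qed.

(* Same for walks on the positive half-line that may also stand still. *)
Fixpoint lazy_walks (n : nat) (x : int) : rat :=
  if n is m.+1 then lazy_walks m (x + 1) + lazy_walks m (x - 1) + lazy_walks m x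
  else (Num.sg x)%:~R.

Lemma lazy_walksN n x : lazy_walks n (- x) = - lazy_walks n x.
Proof.
elim: n x => [|n IH] x /=; first by rewrite sgrN rmorphN.
rewrite (_ : - x + 1 = - (x - 1)); last by ring.
rewrite (_ : - x - 1 = - (x + 1)); last by ring.
by rewrite !IH; ring.
Qed.

Lemma lazy_walks0 n : lazy_walks n 0 = 0.
Proof. by have := lazy_walksN n 0; rewrite oppr0; lra. Qed.

(* Pfaffian count: for [a > b > c > d] the number of ways to make [n] unit moves
   of four particles to the right without collision. *)
Definition walks4 n (a b c d : int) : rat :=
  quadrant_walks n (a - b) (c - d) - quadrant_walks n (a - c) (b - d)
  + quadrant_walks n (a - d) (b - c).

(** A Pfaffian of odd order, bordered by ones. The walks are lazy because a move of the third
    particle leaves the difference of the other two unchanged. *)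
Definition walks3 n (a b c : int) : rat :=
  lazy_walks n (a - b) - lazy_walks n (a - c) + lazy_walks n (b - c).

Lemma walks4S n a b c d :
  walks4 n.+1 a b c d = walks4 n (a + 1) b c d + walks4 n a (b + 1) c d
    + walks4 n a b (c + 1) d + walks4 n a b c (d + 1).
Proof.
have addl (x y : int) : x + 1 - y = x - y + 1 by ring.
have addr (x y : int) : x - (y + 1) = x - y - 1 by ring.
by rewrite /walks4 /= !addl !addr; ring.
Qed.

Lemma walks3S n a b c :
  walks3 n.+1 a b c
  = walks3 n (a + 1) b c + walks3 n a (b + 1) c + walks3 n a b (c + 1).
Proof.
have addl (x y : int) : x + 1 - y = x - y + 1 by ring.
have addr (x y : int) : x - (y + 1) = x - y - 1 by ring.
by rewrite /walks3 /= !addl !addr; ring.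
Qed.

(** Antisymmetry makes [walks4] vanish at collisions, so the recurrence [walks4S] needs no boundary
    cases. *)
Lemma walks4_swap12 n a b c d : walks4 n b a c d = - walks4 n a b c d.
Proof.
rewrite /walks4 -(opprB a b) quadrant_walksN (quadrant_walksC _ (b - c)).
by rewrite (quadrant_walksC _ (b - d)); ring.
Qed.

Lemma walks4_swap23 n a b c d : walks4 n a c b d = - walks4 n a b c d.
Proof.
rewrite /walks4 -(opprB b c) (quadrant_walksC _ _ (- _)) quadrant_walksN.
by rewrite (quadrant_walksC _ (b - c)); ring.
Qed.

Lemma walks4_swap34 n a b c d : walks4 n a b d c = - walks4 n a b c d.
Proof.
rewrite /walks4 -(opprB c d) (quadrant_walksC _ _ (- _)) quadrant_walksN.
by rewrite (quadrant_walksC _ (c - d)); ring.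
Qed.

Lemma walks3_eq12 n a c : walks3 n a a c = 0.
Proof. by rewrite /walks3 (subrr (_ : int)) lazy_walks0; ring. Qed.

Lemma walks3_eq23 n a b : walks3 n a b b = 0.
Proof. by rewrite /walks3 (subrr (_ : int)) lazy_walks0; ring. Qed.

Lemma walks4_eq12 n a c d : walks4 n a a c d = 0.
Proof. by have := walks4_swap12 n a a c d; lra. Qed.

Lemma walks4_eq23 n a b d : walks4 n a b b d = 0.
Proof. by have := walks4_swap23 n a b b d; lra. Qed.

Lemma walks4_eq34 n a b c : walks4 n a b c c = 0.
Proof. by have := walks4_swap34 n a b c c; lra. Qed.

(* Walks with free steps from [x] to the origin. *)
Fixpoint simple_walks (n : nat) (x : int) : rat :=
  if n is m.+1 then simple_walks m (x + 1) + simple_walks m (x - 1)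
  else (x == 0)%:R.

Lemma simple_walksN n x : simple_walks n (- x) = simple_walks n x.
Proof.
elim: n x => [|n IH] x /=; first by rewrite oppr_eq0.
rewrite (_ : - x + 1 = - (x - 1)); last by ring.
rewrite (_ : - x - 1 = - (x + 1)); last by ring.
by rewrite !IH addrC.
Qed.

(* The coordinates [x + y] and [x - y] of a planar walk move independently. *)
Definition plane_walks n (x y : int) := simple_walks n (x + y) * simple_walks n (x - y).

Lemma plane_walksS n x y :
  plane_walks n.+1 x y = plane_walks n (x + 1) y + plane_walks n (x - 1) y
    + plane_walks n x (y + 1) + plane_walks n x (y - 1).
Proof.
rewrite /plane_walks /=.
have -> : x + 1 + y = x + y + 1 by ring.
have -> : x + 1 - y = x - y + 1 by ring.
have -> : x - 1 + y = x + y - 1 by ring.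
have -> : x - 1 - y = x - y - 1 by ring.
have -> : x + (y + 1) = x + y + 1 by ring.
have -> : x - (y + 1) = x - y - 1 by ring.
have -> : x + (y - 1) = x + y - 1 by ring.
have -> : x - (y - 1) = x - y + 1 by ring.
by ring.
Qed.

Lemma sg_step (x : int) : Num.sg (x + 1) - Num.sg x = (x == 0)%:R + (x + 1 == 0)%:R.
Proof. lia. Qed.

(** Both sides obey the same recurrence in [n]. At [n = 0] the difference of signs in each
    coordinate is a sum of two point masses. *)
Lemma quadrant_walks_diff n x y :
  quadrant_walks n (x + 1) (y + 1) - quadrant_walks n x (y + 1)
    - quadrant_walks n (x + 1) y + quadrant_walks n x y
  = plane_walks n x y + plane_walks n (x + 1) y
    + plane_walks n x (y + 1) + plane_walks n (x + 1) (y + 1).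
Proof.
elim: n x y => [|n IH] x y.
  have -> : quadrant_walks 0 (x + 1) (y + 1) - quadrant_walks 0 x (y + 1)
      - quadrant_walks 0 (x + 1) y + quadrant_walks 0 x y
    = ((Num.sg (x + 1) - Num.sg x) * (Num.sg (y + 1) - Num.sg y))%:~R.
    rewrite /=; ring.
  have delta2 (u v : int) : plane_walks 0 u v = (((u == 0)%:R * (v == 0)%:R : int))%:~R.
    rewrite /plane_walks /=.
    have -> : (u + v == 0) = (u == - v) by rewrite addr_eq0.
    have -> : (u - v == 0) = (u == v) by rewrite subr_eq0.
    rewrite -natrM mulnb (_ : (u == - v) && (u == v) = (u == 0) && (v == 0)); last by lia.
    by case: (u == 0); case: (v == 0).
  rewrite !delta2 !sg_step; ring.
have HX := IH (x + 1) y; have HX' := IH (x - 1) y.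
have HY := IH x (y + 1); have HY' := IH x (y - 1).
rewrite !plane_walksS /=.
rewrite ?addrK ?subrK in HX HX' HY HY' *.
lra.
Qed.

Fixpoint lazy_to0 (n : nat) (x : int) : rat :=
  if n is m.+1 then lazy_to0 m (x + 1) + lazy_to0 m (x - 1) + lazy_to0 m x
  else (x == 0)%:R.

Lemma lazy_walks_diff n x :
  lazy_walks n (x + 1) - lazy_walks n x = lazy_to0 n x + lazy_to0 n (x + 1).
Proof.
elim: n x => [|n IH] x /=; first by rewrite -intrB sg_step; ring.
have := IH (x + 1); have := IH (x - 1); have := IH x.
rewrite ?addrK ?subrK; lra.
Qed.

Lemma walks3_origin n : walks3 n 2 1 0 = lazy_to0 n 0 - lazy_to0 n 2.
Proof.
have := lazy_walks_diff n 0; have := lazy_walks_diff n 1.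
by rewrite /walks3 (_ : 2 - 1 = 1 :> int) // !subr0 !add0r lazy_walks0
  (_ : 1 + 1 = 2 :> int) //; lra.
Qed.

(** Four mixed differences, with symmetry and vanishing on the axes, determine the three quadrant
    counts in the Pfaffian. *)
Lemma walks4_origin n : let u j := simple_walks n (Posz j) in
  walks4 n 3%Z 2%Z 1%Z 0%Z
  = u 0%N ^+ 2 + (u 1%N - u 3%N) ^+ 2 - u 2%N * u 0%N - u 4%N * u 0%N + u 4%N * u 2%N.
Proof.
move=> u.
pose Q i j := quadrant_walks n (Posz i) (Posz j).
have WE : walks4 n 3%Z 2%Z 1%Z 0%Z = Q 1%N 1%N - Q 2 2 + Q 3 1%N by [].
have D00 : Q 1%N 1%N - Q 0%N 1%N - Q 1%N 0%N + Q 0%N 0%N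
  = u 0%N * u 0%N + u 1%N * u 1%N + u 1%N * simple_walks n (- 1) + u 2 * u 0%N
  := quadrant_walks_diff n 0 0.
have D10 : Q 2 1%N - Q 1%N 1%N - Q 2 0%N + Q 1%N 0%N
  = u 1%N * u 1%N + u 2 * u 2 + u 2 * u 0%N + u 3 * u 1%N
  := quadrant_walks_diff n 1%Z 0.
have D20 : Q 3 1%N - Q 2 1%N - Q 3 0%N + Q 2 0%N
  = u 2 * u 2 + u 3 * u 3 + u 3 * u 1%N + u 4 * u 2
  := quadrant_walks_diff n 2%Z 0.
have D11 : Q 2 2 - Q 1%N 2 - Q 2 1%N + Q 1%N 1%N
  = u 2 * u 0%N + u 3 * u 1%N + u 3 * simple_walks n (- 1) + u 4 * u 0%N
  := quadrant_walks_diff n 1%Z 1%Z.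
have Q0 j : Q 0%N j = 0 by apply: quadrant_walks0.
have QC i j : Q i j = Q j i by apply: quadrant_walksC.
rewrite simple_walksN -/(u 1%N) in D00 D11.
rewrite WE expr2 sqrrB.
rewrite ?(QC _ 0%N) ?Q0 in D00 D10 D20; rewrite (QC 1%N 2) in D11.
lra.
Qed.

(** * Binomial, Catalan and Motzkin evaluations *)

Lemma simple_walks_eq0 n x : (n < `|x|)%N -> simple_walks n x = 0.
Proof.
elim: n x => [|n IH] x hx /=; first by case: eqP => // x0; move: hx; rewrite x0.
by rewrite !IH ?addr0 //; lia.
Qed.

(** Exactly [i] of the [n] steps go down; the recurrence is Pascal's rule. *)
Lemma simple_walks_bin n i : simple_walks n (i.*2%:Z - n%:Z) = ('C(n, i))%:R.
Proof.
elim: n i => [|n IH] i /=; first by case: i => [|i] //; rewrite bin0n.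
have -> : i.*2%:Z - n.+1%:Z + 1 = i.*2%:Z - n%:Z by lia.
case: i => [|i]; first by rewrite IH simple_walks_eq0 ?bin0 ?addr0 //; lia.
have -> : i.+1.*2%:Z - n.+1%:Z - 1 = i.*2%:Z - n%:Z by lia.
by rewrite !IH binS natrD.
Qed.

Lemma simple_walks_odd n x : odd (n + `|x|) -> simple_walks n x = 0.
Proof.
elim: n x => [|n IH] x hx /=; first by case: eqP => // x0; move: hx; rewrite x0.
by rewrite !IH ?addr0 //; lia.
Qed.

Lemma simple_walks_even n j : simple_walks n.*2 (j.*2)%:Z = ('C(n.*2, n + j))%:R.
Proof. by rewrite -simple_walks_bin; congr simple_walks; lia. Qed.

Lemma binom_mid_step n j : ('C(n.*2, n + j.+1) * (n + j.+1) = 'C(n.*2, n + j) * (n - j))%N.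
Proof.
rewrite addnS mulnC mul_bin_left (_ : n.*2 - (n + j) = n - j)%N 1?mulnC //; lia.
Qed.

Lemma catalan_diff n : (('C(n.*2, n))%:R : rat) - ('C(n.*2, n.+1))%:R = catalan n.
Proof.
have := binom_mid_step n 0; rewrite addn1 addn0 subn0 /catalan => /(congr1 (GRing.natmul (1 : rat))).
rewrite !natrM => H.
have n1 : (n.+1%:R : rat) != 0 by rewrite pnatr_eq0.
rewrite (_ : ('C(n.*2, n.+1))%:R = ('C(n.*2, n))%:R * n%:R / n.+1%:R :> rat).
  by rewrite -natr1 in n1 *; field.
by rewrite -H mulfK.
Qed.

(** The reflection principle's expression for the number of Dyck paths. *)
Lemma catalan_walks n : catalan n = simple_walks n.*2 0 - simple_walks n.*2 2%Z.
Proof.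
by rewrite -catalan_diff (simple_walks_even n 0) (simple_walks_even n 1) addn0 addn1.
Qed.

Lemma catalanS_walks n : catalan n.+1 = simple_walks n.*2.+1 1 - simple_walks n.*2.+1 3%Z.
Proof.
have := simple_walksN n.*2.+1 1; rewrite catalan_walks doubleS => H.
have -> : simple_walks n.*2.+2 0 = simple_walks n.*2.+1 1 + simple_walks n.*2.+1 (- 1) by [].
have -> : simple_walks n.*2.+2 2%Z = simple_walks n.*2.+1 3%Z + simple_walks n.*2.+1 1 by [].
by rewrite H; ring.
Qed.

(** By parity, [walks4_origin] reduces to [(u 0 - u 2) * (u 0 - u 4)] for even [n] and to
    [(u 1 - u 3) ^+ 2] for odd [n]. *)
Lemma walks4_catalan n :
  walks4 n 3%Z 2%Z 1%Z 0%Z = catalan n.+1./2 * catalan n.+2./2.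
Proof.
have : n = n./2.*2 \/ n = n./2.*2.+1 by lia.
move: n./2 => p [->|->].
- rewrite walks4_origin (simple_walks_odd _ 1%Z) ?(simple_walks_odd _ 3%Z); try lia.
  have -> : p.*2.+1./2 = p by lia.
  have -> : p.*2.+2./2 = p.+1 by lia.
  rewrite (catalan_walks p) catalanS_walks.
  have -> : simple_walks p.*2.+1 1 = simple_walks p.*2 2%Z + simple_walks p.*2 0 by [].
  have -> : simple_walks p.*2.+1 3%Z = simple_walks p.*2 4%Z + simple_walks p.*2 2%Z by [].
  by ring.
- rewrite walks4_origin (simple_walks_odd _ 0%Z) ?(simple_walks_odd _ 2%Z) ?(simple_walks_odd _ 4%Z); try lia.
  have -> : p.*2.+2./2 = p.+1 by lia.
  have -> : p.*2.+3./2 = p.+1 by lia.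
  by rewrite catalanS_walks; ring.
Qed.

(** The index [i] is the number of times at which the lazy walk moves. *)
Lemma lazy_to0_sum n x :
  lazy_to0 n x = \sum_(i < n.+1) ('C(n, i))%:R * simple_walks i x.
Proof.
elim: n x => [|n IH] x; first by rewrite big_ord1 bin0 mul1r.
have pascal i : ('C(n.+1, i.+1))%:R * simple_walks i.+1 x
  = ('C(n, i.+1))%:R * simple_walks i.+1 x
    + (('C(n, i))%:R * simple_walks i (x + 1) + ('C(n, i))%:R * simple_walks i (x - 1)).
  by rewrite binS natrD /=; ring.
rewrite [RHS]big_ord_recl /=.
under [in RHS]eq_bigr => i _ do rewrite pascal.
rewrite !big_split /= -!IH.
rewrite [X in _ = _ + (X + _)]big_ord_recr /= (bin_small (ltnSn n)) mulr0n mul0r addr0.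
have := IH x; rewrite big_ord_recl !bin0 /=.
lra.
Qed.

Lemma big_double_ord (V : nmodType) n (F : nat -> V) :
  \sum_(i < n.*2) F i = \sum_(i < n) (F i.*2 + F i.*2.+1).
Proof.
elim: n => [|n IH]; first by rewrite !big_ord0.
by rewrite doubleS !big_ord_recr /= IH addrA.
Qed.

Lemma walks3_motzkin n : walks3 n 2 1 0 = motzkin n.
Proof.
rewrite walks3_origin !lazy_to0_sum -sumrB /motzkin.
pose F i : rat := ('C(n, i))%:R * (simple_walks i 0 - simple_walks i 2%Z).
transitivity (\sum_(i < n.+1) F i); first by apply: eq_bigr => i _; rewrite /F mulrBr.
(* Padding with vanishing binomials lets the indices be paired; the odd ones then drop out by
   parity. *)
transitivity (\sum_(i < n.+1.*2) F i).
  rewrite -addnn big_split_ord /= [X in _ = _ + X]big1 ?addr0 // => i _.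
  by rewrite /F bin_small ?mul0r //; lia.
rewrite big_double_ord; apply: eq_bigr => i _.
rewrite /F -catalan_walks !simple_walks_odd; try lia.
by rewrite /catalan; ring.
Qed.

(** * Growth of a shape until it has a single cell in row five *)

(* The arguments [a > b > c > d] stand for [mu i + 3 - i]. The negative term
   counts the removals at the end of the growth through the additions there; the
   removal in row four, or the correction when that row is empty, is the term
   added in the next two definitions. *)
Definition removals n (a b c d : int) : rat :=
  n%:R * walks4 n.-1 a b c d
  + walks4 n (a - 1) b c d + walks4 n a (b - 1) c d + walks4 n a b (c - 1) d
  - walks4 n.+1 a b c d.

Definition growth_formula_pos n a b c d : rat := removals n a b c d + walks4 n a b c (d - 1).

Definition growth_formula_empty4 n a b c d : rat := removals n a b c d + walks3 n a b c.

(** At [n = 0], where [n.-1] is again [0], the factor [n] kills both sides. *)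
Lemma natr_walks4 n a b c d : n%:R * walks4 n a b c d
  = n%:R * (walks4 n.-1 (a + 1) b c d + walks4 n.-1 a (b + 1) c d
    + walks4 n.-1 a b (c + 1) d + walks4 n.-1 a b c (d + 1)).
Proof. by case: n => [|n]; rewrite ?mul0r // walks4S. Qed.

(** The extra [walks4 n a b c d], left over from the factor [n.+1], accounts for adding the cell of
    row five. *)
Lemma growth_formula_posS n a b c d :
  growth_formula_pos n.+1 a b c d
  = growth_formula_pos n (a + 1) b c d + growth_formula_pos n a (b + 1) c d
    + growth_formula_pos n a b (c + 1) d + growth_formula_pos n a b c (d + 1)
    + walks4 n a b c d.
Proof.
rewrite /growth_formula_pos /removals /= -natr1 mulrDl natr_walks4 mul1r.
rewrite (walks4S n.+1) !(walks4S n (_ - 1)) !(walks4S n _ (_ - 1)).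
rewrite !(walks4S n _ _ (_ - 1)) !(walks4S n _ _ _ (_ - 1)) ?addrK ?subrK.
by ring.
Qed.

(** Here the extra [walks4 n a b c d] is the row-four removal term of the last summand, whose fourth
    row is nonempty. *)
Lemma growth_formula_empty4S n a b c d :
  growth_formula_empty4 n.+1 a b c d
  = growth_formula_empty4 n (a + 1) b c d + growth_formula_empty4 n a (b + 1) c d
    + growth_formula_empty4 n a b (c + 1) d + growth_formula_pos n a b c (d + 1).
Proof.
rewrite /growth_formula_empty4 /growth_formula_pos /removals /= -natr1 mulrDl natr_walks4 mul1r.
rewrite (walks4S n.+1) !(walks4S n (_ - 1)) !(walks4S n _ (_ - 1)).
rewrite !(walks4S n _ _ (_ - 1)) walks3S ?addrK ?subrK.
by ring.
Qed.

(** At a collision the removals in the two rows cancel by antisymmetry; all other terms vanish. *)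
Lemma growth_formula_pos_eq12 n a c d : growth_formula_pos n a a c d = 0.
Proof.
rewrite /growth_formula_pos /removals (walks4_swap12 _ a (a - 1)) !walks4_eq12; ring.
Qed.

Lemma growth_formula_pos_eq23 n a b d : growth_formula_pos n a b b d = 0.
Proof.
rewrite /growth_formula_pos /removals (walks4_swap23 _ a b (b - 1)) !walks4_eq23; ring.
Qed.

Lemma growth_formula_pos_eq34 n a b c : growth_formula_pos n a b c c = 0.
Proof.
rewrite /growth_formula_pos /removals (walks4_swap34 _ a b c (c - 1)) !walks4_eq34; ring.
Qed.

Lemma growth_formula_empty4_eq12 n a c d : growth_formula_empty4 n a a c d = 0.
Proof.
rewrite /growth_formula_empty4 /removals (walks4_swap12 _ a (a - 1)) !walks4_eq12 walks3_eq12; ring.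
Qed.

Lemma growth_formula_empty4_eq23 n a b d : growth_formula_empty4 n a b b d = 0.
Proof.
rewrite /growth_formula_empty4 /removals (walks4_swap23 _ a b (b - 1)) !walks4_eq23 walks3_eq23; ring.
Qed.

Lemma growthsS n mu : growths n.+1 mu =
  (growths n (incr 0%N mu) + (if mu 1%N < mu 0%N then growths n (incr 1%N mu) else 0)
  + (if mu 2%N < mu 1%N then growths n (incr 2%N mu) else 0)
  + (if mu 3%N < mu 2%N then growths n (incr 3%N mu) else 0)
  + (if mu 4%N < mu 3%N then growths n (incr 4%N mu) else 0))%N.
Proof. by rewrite /= !big_ord_recr big_ord0. Qed.

Lemma growths_ge2 n mu : (2 <= mu 4%N)%N -> growths n mu = 0%N.
Proof.
elim: n mu => [|n IH] mu hmu; first by rewrite /=; lia.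
by rewrite growthsS !IH /incr /= ?addn0 ?addn1 ?if_same //; lia.
Qed.

Definition nonincr5 (mu : nat -> nat) : bool :=
  [&& mu 4%N <= mu 3%N, mu 3%N <= mu 2%N, mu 2%N <= mu 1%N & mu 1%N <= mu 0%N]%N.

Lemma walks4_0 (a b c d : int) : b < a -> c < b -> d < c -> walks4 0 a b c d = 1.
Proof.
move=> ab bc cd; rewrite /walks4 /= !gtr0_sg; try lia.
by rewrite !mul1r; ring.
Qed.

Lemma walks3_0 (a b c : int) : b < a -> c < b -> walks3 0 a b c = 1.
Proof. by move=> ab bc; rewrite /walks3 /= !gtr0_sg //; lia. Qed.

(** A row can lose a cell exactly when the next row can gain one: both mean that the gap between the
    two particles exceeds one. *)
Lemma walks4_0_move (a b c d : int) : b < a -> c < b -> d < c ->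
  [/\ walks4 0 (a - 1) b c d = walks4 0 a (b + 1) c d,
      walks4 0 a (b - 1) c d = walks4 0 a b (c + 1) d &
      walks4 0 a b (c - 1) d = walks4 0 a b c (d + 1)].
Proof.
move=> ab bc cd; split.
- have [e|e] := eqVneq (a - 1) b.
    by rewrite (_ : b + 1 = a) ?e ?walks4_eq12 //; lia.
  by rewrite !walks4_0 //; lia.
- have [e|e] := eqVneq (b - 1) c.
    by rewrite (_ : c + 1 = b) ?e ?walks4_eq23 //; lia.
  by rewrite !walks4_0 //; lia.
- have [e|e] := eqVneq (c - 1) d.
    by rewrite (_ : d + 1 = c) ?e ?walks4_eq34 //; lia.
  by rewrite !walks4_0 //; lia.
Qed.

(** After this pairing only the addition in row one and the removal in row four remain, and they
    cancel. *)
Lemma growth_formula_pos_0 (a b c d : int) : b < a -> c < b -> d < c ->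
  growth_formula_pos 0 a b c d = 0.
Proof.
move=> ab bc cd; rewrite /growth_formula_pos /removals walks4S mul0r.
case: (walks4_0_move a b c d) => // -> -> ->.
by rewrite (walks4_0 (a + 1)) ?(walks4_0 a b c (d - 1)); try lia; ring.
Qed.

Lemma growth_formula_empty4_0 (a b c d : int) : b < a -> c < b -> d < c ->
  growth_formula_empty4 0 a b c d = 0.
Proof.
move=> ab bc cd; rewrite /growth_formula_empty4 /removals walks4S mul0r walks3_0 //.
case: (walks4_0_move a b c d) => // -> -> ->.
by rewrite (walks4_0 (a + 1)); try lia; ring.
Qed.

(** A second cell in row five is fatal, so only four rows still grow; a forbidden addition is a
    collision, where [walks4] vanishes. *)
Lemma growths_1 n mu : nonincr5 mu -> mu 4%N = 1%N ->
  (growths n mu)%:R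
  = walks4 n ((mu 0%N)%:Z + 3%Z) ((mu 1%N)%:Z + 2%Z) ((mu 2%N)%:Z + 1) (mu 3%N)%:Z.
Proof.
elim: n mu => [|n IH] mu /and4P[h4 h3 h2 h1] he.
  by rewrite /= he walks4_0 //; lia.
have mono i : addable i mu -> (i < 4)%N -> nonincr5 (incr i mu).
  by rewrite /addable /nonincr5 /incr; case: i => [|[|[|[|i]]]] //=; lia.
have term i : (i < 4)%N -> addable i mu ->
    (growths n (incr i mu))%:R
    = walks4 n ((incr i mu 0%N)%:Z + 3%Z) ((incr i mu 1%N)%:Z + 2%Z)
        ((incr i mu 2%N)%:Z + 1) (incr i mu 3%N)%:Z.
  move=> hi ai; apply: IH; first exact: mono.
  by rewrite /incr he; lia.
rewrite growthsS !natrD (growths_ge2 n (incr 4%N mu)); last by rewrite /incr he.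
rewrite if_same addr0 walks4S (term 0%N) //; congr (_ + _ + _ + _).
- by rewrite /incr; congr walks4; lia.
- case: ltnP => h; first by rewrite (term 1%N) // /incr; congr walks4; lia.
  by rewrite (_ : _ + 2%Z + 1 = (mu 0%N)%:Z + 3%Z) ?walks4_eq12 //; lia.
- case: ltnP => h; first by rewrite (term 2%N) // /incr; congr walks4; lia.
  by rewrite (_ : _ + 1 + 1 = (mu 1%N)%:Z + 2%Z) ?walks4_eq23 //; lia.
- case: ltnP => h; first by rewrite (term 3%N) // /incr; congr walks4; lia.
  by rewrite (_ : (mu 3%N)%:Z + 1 = (mu 2%N)%:Z + 1) ?walks4_eq34 //; lia.
Qed.

Definition growth_formula n mu : rat :=
  (if mu 3%N == 0%N then growth_formula_empty4 else growth_formula_pos)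
    n ((mu 0%N)%:Z + 3%Z) ((mu 1%N)%:Z + 2%Z) ((mu 2%N)%:Z + 1) (mu 3%N)%:Z.

Lemma growths_0 n mu : nonincr5 mu -> mu 4%N = 0%N -> (growths n mu)%:R = growth_formula n mu.
Proof.
elim: n mu => [|n IH] mu /and4P[h4 h3 h2 h1] he.
  rewrite /= he /growth_formula.
  by case: ifP => _; rewrite ?growth_formula_empty4_0 ?growth_formula_pos_0 //; lia.
have mono i : addable i mu -> (i < 4)%N -> nonincr5 (incr i mu).
  by rewrite /addable /nonincr5 /incr; case: i => [|[|[|[|i]]]] //=; lia.
have term i : (i < 4)%N -> addable i mu ->
    (growths n (incr i mu))%:R = growth_formula n (incr i mu).
  move=> hi ai; apply: IH; first exact: mono.
  by rewrite /incr he; lia.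
rewrite growthsS !natrD (term 0%N) // /growth_formula.
have [d0|d0] := eqVneq (mu 3%N) 0%N.
  rewrite growth_formula_empty4S d0 he /= addr0; congr (_ + _ + _ + _).
  - by rewrite /incr d0 /=; f_equal; lia.
  - case: ltnP => h; first by rewrite (term 1%N) // /growth_formula /incr d0 /=; f_equal; lia.
    by rewrite (_ : _ + 2%Z + 1 = (mu 0%N)%:Z + 3%Z) ?growth_formula_empty4_eq12 //; lia.
  - case: ltnP => h; first by rewrite (term 2%N) // /growth_formula /incr d0 /=; f_equal; lia.
    by rewrite (_ : _ + 1 + 1 = (mu 1%N)%:Z + 2%Z) ?growth_formula_empty4_eq23 //; lia.
  (* This addition makes row four nonempty, hence the change of formula. *)
  - case: ltnP => h.
      by rewrite (term 3%N) /addable ?d0 // /growth_formula /incr d0 /=; f_equal; lia.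
    by rewrite (_ : 0%Z + 1 = (mu 2%N)%:Z + 1) ?growth_formula_pos_eq34 //; lia.
have pos i : (incr i mu 3%N == 0%N) = false by rewrite /incr; lia.
rewrite growth_formula_posS pos; congr (_ + _ + _ + _ + _).
- by rewrite /incr; f_equal; lia.
- case: ltnP => h; first by rewrite (term 1%N) // /growth_formula pos /incr; f_equal; lia.
  by rewrite (_ : _ + 2%Z + 1 = (mu 0%N)%:Z + 3%Z) ?growth_formula_pos_eq12 //; lia.
- case: ltnP => h; first by rewrite (term 2%N) // /growth_formula pos /incr; f_equal; lia.
  by rewrite (_ : _ + 1 + 1 = (mu 1%N)%:Z + 2%Z) ?growth_formula_pos_eq23 //; lia.
- case: ltnP => h; first by rewrite (term 3%N) // /growth_formula pos /incr; f_equal; lia.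
  by rewrite (_ : (mu 3%N)%:Z + 1 = (mu 2%N)%:Z + 1) ?growth_formula_pos_eq34 //; lia.
(* Row five receives its cell; [growths_1] counts the rest and supplies the extra term of
   [growth_formula_posS]. *)
- rewrite ifT; last by lia.
  rewrite growths_1 /incr ?he //; last by rewrite /nonincr5 /=; lia.
  by congr walks4; lia.
Qed.

(** The particles start adjacent at 3, 2, 1, 0, so the three removal terms are collisions. *)
Lemma growths_empty n :
  (growths n (fun=> 0%N))%:R
  = n%:R * catalan n./2 * catalan n.+1./2 - catalan n.+2./2 * catalan n.+3./2 + motzkin n :> rat.
Proof.
have -> : n%:R * catalan n./2 * catalan n.+1./2 = n%:R * walks4 n.-1 3%Z 2%Z 1%Z 0%Z.
  by case: n => [|n]; rewrite ?mul0r // walks4_catalan mulrA.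
rewrite growths_0 //.
have -> : growth_formula n (fun=> 0%N) = n%:R * walks4 n.-1 3%Z 2%Z 1%Z 0%Z
    + walks4 n 2%Z 2%Z 1%Z 0%Z + walks4 n 3%Z 1%Z 1%Z 0%Z + walks4 n 3%Z 2%Z 0%Z 0%Z
    - walks4 n.+1 3%Z 2%Z 1%Z 0%Z + walks3 n 2%Z 1%Z 0%Z by [].
rewrite walks4_eq12 walks4_eq23 walks4_eq34 !addr0.
by rewrite (walks4_catalan n.+1) -walks3_motzkin.
Qed.

(** * The stated closed form *)

Lemma catalanS n : catalan n.+1 * n.+2%:R = 2 * n.*2.+1%:R * catalan n.
Proof.
have e1 : (n.+1 * 'C(n.*2.+1, n.+1) = n.*2.+1 * 'C(n.*2, n))%N by rewrite -mul_bin_diag.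
have e2 : 'C(n.*2.+1, n) = 'C(n.*2.+1, n.+1).
  by rewrite -bin_sub; [congr 'C(_, _); lia | lia].
have e3 : 'C(n.*2.+2, n.+1) = (2 * 'C(n.*2.+1, n.+1))%N by rewrite binS e2; lia.
have n1 : (n.+1%:R : rat) != 0 by rewrite pnatr_eq0.
have n2 : (n.+2%:R : rat) != 0 by rewrite pnatr_eq0.
rewrite /catalan doubleS e3 natrM mulrAC mulVf // mul1r.
apply: (mulfI n1); rewrite mulrCA -(natrM _ n.+1) e1 natrM.
by move: (n.+1%:R) n1 => y y0; field.
Qed.

(* Sum over partitions la of k with exactly 5 parts and la_5 = 1; such la are
   encoded as 5-tuples of naturals <= k.  floor((k+1)/2) = (k+1)./2,
   ceil((k+1)/2) = (k+2)./2, floor(k/2) = k./2, ceil(k/2) = (k+1)./2. *)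
Theorem mainTheorem10 (k : nat) (hk : (3 <= k)%N) :
  ((\sum_(t : 5.-tuple 'I_k.+1 |
          is_partition k (map (@nat_of_ord _) t) && (nat_of_ord (tnth t (inord 4)) == 1%N))
      num_SYT (map (@nat_of_ord _) t))%N)%:R
  = ((k.+1)./2)%:R * (((k.+2)./2).+1)%:R / (k.+1)%:R
      * catalan (k.+1)./2 * catalan (k.+2)./2
    - catalan (k./2).+1 * catalan ((k.+1)./2).+1
    + motzkin k.
Proof.
rewrite sum_num_SYT_growths growths_empty; congr (_ - _ + _).
set m := k./2; have -> : k.+2./2 = m.+1 by rewrite /m; lia.
set p := k.+1./2.
have k1 : (k.+1%:R : rat) != 0 by rewrite pnatr_eq0.
(* With [catalanS], this identity turns the stated first term into [k * catalan m * catalan p], for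
   either parity of [k]. *)
have size_eq : (p * (2 * m.*2.+1) = k * k.+1)%N.
  have : k = m.*2 /\ p = m \/ k = m.*2.+1 /\ p = m.+1 by rewrite /m /p; lia.
  by case=> [[-> ->]|[-> ->]]; rewrite -!muln2; nia.
have /(congr1 (GRing.natmul (1 : rat))) := size_eq; rewrite !natrM.
move: (k.+1%:R : rat) k1 => y y0 E.
transitivity (p%:R * (catalan m.+1 * m.+2%:R) * catalan p / y).
  rewrite catalanS (_ : p%:R * _ = k%:R * y * catalan m); last by rewrite -E; ring.
  by field.
by field.
Qed.
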